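(* Let $(X,T)$ be a semiflow and let $x_0 \in X$. Then the orbit closure $\overline{Tx_0}$ is minimal if and only if $x_0$ is a semiflow almost periodic point.
   Context: A semiflow $(X,T)$ consists of a compact Hausdorff space $X$, a topological monoid $T$ with identity $e$, and a continuous map $\pi: T\times X\to X$, written $\pi(t,x)=tx$, with $ex=x$ and $(ts)x=t(sx)$ for all $t,s\in T$, $x\in X$. For $x\in X$, $Tx=\{tx: t\in T\}$ is the orbit and $\overline{Tx}$ is the orbit closure. A subset $A\subseteq X$ is invariant if $TA\subseteq A$. A subset $M\subseteq X$ is minimal if it is non-empty, closed and invariant, and is minimal (under inclusion) with respect to these properties. For $x\in X$ and an open set $U\ni x$, put $A_U:=\{t\in T: tx\in U\}$. The point $x$ is called a semiflow almost periodic point if for every open $U\ni x$ there exists a finite set $K\subset T$ such that $Kt\cap A_U\neq\emptyset$ for all $t\in T$, where $Kt=\{kt: k\in K\}$. *)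

(* Defs.v *)
From HB Require Import structures.
From mathcomp Require Import all_boot all_order all_algebra.
From mathcomp Require Import boolp classical_sets functions cardinality topology.

Set Implicit Arguments.
Unset Strict Implicit.
Unset Printing Implicit Defensive.

Local Open Scope classical_set_scope.

HB.mixin Record Monoid_isTopological T of Monoid T & Topological T := {
  mulg_continuous : continuous (fun st : T * T => (st.1 * st.2)%g)
}.

(* Multiplication is jointly continuous; no separation axiom is imposed on T. *)
#[short(type="topologicalMonoidType")]
HB.structure Definition TopologicalMonoid :=
  {T of Monoid_isTopological T & Monoid T & Topological T}.

Record semiflow (X : topologicalType) (T : topologicalMonoidType) := Semiflow {
  semiflow_act :> T -> X -> X;
  semiflow_compact : compact [set: X];
  semiflow_hausdorff : hausdorff_space X;
  semiflow_continuous :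
    continuous (fun tx : T * X => semiflow_act tx.1 tx.2);
  semiflow_act1 : forall x : X, semiflow_act 1%g x = x;
  semiflow_actM : forall (t s : T) (x : X),
    semiflow_act (t * s)%g x = semiflow_act t (semiflow_act s x)
}.

Definition semiflow_orbit (X : topologicalType) (T : topologicalMonoidType)
    (pi : semiflow X T) (x : X) : set X :=
  [set pi t x | t in [set: T]].

Definition orbit_closure (X : topologicalType) (T : topologicalMonoidType)
    (pi : semiflow X T) (x : X) : set X :=
  closure (semiflow_orbit pi x).

Definition semiflow_invariant (X : topologicalType) (T : topologicalMonoidType)
    (pi : semiflow X T) (A : set X) : Prop :=
  [set pi t x | t in [set: T] & x in A] `<=` A.

Definition nonempty_closed_invariant (X : topologicalType)
    (T : topologicalMonoidType) (pi : semiflow X T) (A : set X) : Prop :=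
  [/\ A !=set0, closed A & semiflow_invariant pi A].

Definition semiflow_minimal (X : topologicalType) (T : topologicalMonoidType)
    (pi : semiflow X T) (M : set X) : Prop :=
  nonempty_closed_invariant pi M /\
  forall N : set X, nonempty_closed_invariant pi N -> N `<=` M -> N = M.

Definition return_times (X : topologicalType) (T : topologicalMonoidType)
    (pi : semiflow X T) (x : X) (U : set X) : set T :=
  [set t | U (pi t x)].

Definition semiflow_almost_periodic (X : topologicalType)
    (T : topologicalMonoidType) (pi : semiflow X T) (x : X) : Prop :=
  forall U : set X, open U -> U x ->
  exists K : set T, finite_set K /\
  forall t : T, [set (k * t)%g | k in K] `&` return_times pi x U !=set0.

(* Main.v *)
From HB Require Import structures.
Require Import Defs.
From mathcomp Require Import all_boot all_order all_algebra finmap.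
From mathcomp Require Import boolp classical_sets functions cardinality topology.

(* If M, the orbit closure of x, is minimal, then every point of M has x in its
   orbit closure, so the preimages of a neighbourhood U of x under the maps of T
   cover M; a finite subcover gives K. Conversely, if x is almost periodic, every
   point of M visits every neighbourhood of x, so a nonempty closed invariant
   subset of M must contain x. *)

Set Implicit Arguments.
Unset Strict Implicit.
Unset Printing Implicit Defensive.

Local Open Scope classical_set_scope.

Lemma closure_sub_closed (X : topologicalType) (A C : set X) :
  closed C -> A `<=` C -> closure A `<=` C.
Proof. by move=> /closure_id {2}-> AC; exact: closureS. Qed.

(* [compact_cover] is stated for pointed spaces; a point of the compact set
   supplies the missing structure. *)
Lemma compact_cover_nonempty (X : topologicalType) (A : set X) :
  A !=set0 -> compact A -> cover_compact A.
Proof.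
move=> [x _] cA; pose Y : ptopologicalType :=
  HB.pack_for ptopologicalType X (isPointed.Build X x).
have : @compact Y A by exact: cA.
by rewrite compact_cover; exact.
Qed.

Section Semiflow.
Context (X : topologicalType) (T : topologicalMonoidType) (pi : semiflow X T).

Lemma semiflow_act_continuous (t : T) : continuous (pi t).
Proof.
move=> x; apply: (@cvg_comp _ _ _ (fun y => (t, y)) (fun ty => pi ty.1 ty.2)
  _ (nbhs (t, x))).
  exact: cvg_pair (cvg_cst t) cvg_id.
exact: (@semiflow_continuous _ _ pi (t, x)).
Qed.

Lemma closed_preimage_act (t : T) (C : set X) :
  closed C -> closed (pi t @^-1` C).
Proof.
by move=> cC; move: (@semiflow_act_continuous t) => /continuous_closedP; exact.
Qed.

Lemma open_preimage_act (t : T) (U : set X) : open U -> open (pi t @^-1` U).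
Proof.
by move=> oU; move: (@semiflow_act_continuous t) => /continuousP; exact.
Qed.

Lemma orbit_closure_id (x : X) : orbit_closure pi x x.
Proof. by apply: subset_closure; exists 1%g => //; exact: semiflow_act1. Qed.

Lemma orbit_closure_act (x : X) (t : T) : orbit_closure pi x (pi t x).
Proof. by apply: subset_closure; exists t. Qed.

Lemma orbit_closure_closed (x : X) : closed (orbit_closure pi x).
Proof. exact: closed_closure. Qed.

(** For fixed [t], the preimage of the orbit closure under [pi t] is closed and, by the action law,
    contains the orbit; hence it contains the closure. *)
Lemma orbit_closure_invariant (x : X) :
  semiflow_invariant pi (orbit_closure pi x).
Proof.
move=> _ [t _ [y xy <-]]; move: y xy.
apply: closure_sub_closed.
  apply: closed_preimage_act; exact: orbit_closure_closed.
by move=> _ [s _ <-] /=; rewrite -semiflow_actM; exact: orbit_closure_act.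
Qed.

Lemma orbit_closure_nonempty_closed_invariant (x : X) :
  nonempty_closed_invariant pi (orbit_closure pi x).
Proof.
split; [|exact: orbit_closure_closed|exact: orbit_closure_invariant].
by exists x; exact: orbit_closure_id.
Qed.

Lemma orbit_closure_sub (x : X) (N : set X) :
  closed N -> semiflow_invariant pi N -> N x -> orbit_closure pi x `<=` N.
Proof.
move=> cN iN Nx; apply: closure_sub_closed => // _ [t _ <-].
by apply: iN; exists t => //; exists x.
Qed.

Lemma minimal_almost_periodic (x : X) :
  semiflow_minimal pi (orbit_closure pi x) -> semiflow_almost_periodic pi x.
Proof.
move=> [_ minx] U oU Ux.
have cover_x : orbit_closure pi x `<=` cover [set: T] (fun t => pi t @^-1` U).
  move=> y xy.
  (* The orbit closure of [y] is a competitor inside that of [x], so minimality forces equality. *)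
  have eq_yx : orbit_closure pi y = orbit_closure pi x.
    apply: minx; first exact: orbit_closure_nonempty_closed_invariant.
    apply: orbit_closure_sub => //; first exact: orbit_closure_closed.
    exact: orbit_closure_invariant.
  have : orbit_closure pi y x by rewrite eq_yx; exact: orbit_closure_id.
  by move=> /(_ U (open_nbhs_nbhs (conj oU Ux)))[_ [[t _ <-] Uty]]; exists t.
have : compact (orbit_closure pi x).
  by apply: subclosed_compact (semiflow_compact pi) _ => //;
    exact: orbit_closure_closed.
move/compact_cover_nonempty=> /(_ (ex_intro _ x (@orbit_closure_id x))).
move=> /(_ _ _ _ _ cover_x)[t _|K _ coverK].
  exact: open_preimage_act.
exists [set` K]; split=> [|t]; first exact: finite_fset.
(* Evaluating the subcover at [pi t x] gives a [k] that depends on [t] but stays in the fixed finite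
   set [K]. *)
have [k Kk Uktx] := coverK _ (@orbit_closure_act x t).
exists (k * t)%g; split; first by exists k.
by rewrite /return_times /= semiflow_actM.
Qed.

(* Shrinking U to V with closure V inside U, the orbit of x lies in the closed
   set of those y moved into closure V by some k in the finite set K; hence so
   does its closure. *)
Lemma almost_periodic_orbit_closure (x : X) (U : set X) :
  semiflow_almost_periodic pi x -> open U -> U x ->
  forall y, orbit_closure pi x y -> exists t : T, U (pi t y).
Proof.
move=> apx oU Ux.
have [V nV VU] : filter_from (nbhs x) closure U.
  apply: (compact_regular (@semiflow_hausdorff _ _ pi) (semiflow_compact pi)).
    exact: filterT.
  exact: open_nbhs_nbhs.
(* [V] is only a neighbourhood of [x], so almost periodicity is applied to its interior. *)
have [K [finK returnK]] :=
  apx _ (open_interior V) (nbhs_singleton (nbhs_interior nV)).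
move=> y xy.
suff : (\bigcup_(k in K) pi k @^-1` closure V) y.
  by move=> [k _ Vky]; exists k; exact: VU.
apply: closure_sub_closed xy.
  (* Finiteness of [K] makes this union of closed preimages closed. *)
  by apply: closed_bigcup => // k _; apply: closed_preimage_act; exact: closed_closure.
move=> _ [t _ <-]; have [_ [[k Kk <-] Vktx]] := returnK t.
exists k => //=; rewrite -semiflow_actM.
by apply: subset_closure; exact: interior_subset.
Qed.

Lemma almost_periodic_minimal (x : X) :
  semiflow_almost_periodic pi x -> semiflow_minimal pi (orbit_closure pi x).
Proof.
move=> apx; split; first exact: orbit_closure_nonempty_closed_invariant.
move=> N [[y Ny] cN iN] Nx; apply/seteqP; split=> //.
(* If [x] were outside [N], the orbit of [y] would enter the open complement of [N], whereas
   invariance keeps it inside [N]. *)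
apply: orbit_closure_sub => //; apply: contrapT => nNx.
have [t] := almost_periodic_orbit_closure apx (closed_openC cN) nNx (Nx _ Ny).
by apply; apply: iN; exists t => //; exists y.
Qed.

End Semiflow.

Theorem theorem2p4 (X : topologicalType) (T : topologicalMonoidType)
    (pi : semiflow X T) (x0 : X) :
  semiflow_minimal pi (orbit_closure pi x0) <->
  semiflow_almost_periodic pi x0.
Proof.
split; [exact: minimal_almost_periodic|exact: almost_periodic_minimal].
Qed.
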